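(* Let $0<\phi_0<\phi_1<\frac{\pi}{2}$. The function $$T_{C_r}(\alpha):=2T(\alpha)+T_1(\alpha,\phi_0)-T_1(\alpha,\phi_1),\qquad \alpha\in\left(\phi_1,\tfrac{\pi}{2}\right),$$ is strictly increasing, satisfies $T_{C_r}(\alpha)\to T_*$ as $\alpha\downarrow\phi_1$, where $T_*:=T(\phi_1)+T_1(\phi_1,\phi_0)$, and satisfies $T_{C_r}(\alpha)>T_*$ for all $\alpha\in(\phi_1,\frac{\pi}{2})$.
   Context: For $\alpha\in(0,\frac{\pi}{2})$ define $T(\alpha):=\int_0^{\alpha}\frac{dx}{\sqrt{\cos 2x-\cos 2\alpha}}$, and for $0<\phi\le\alpha$ define $T_1(\alpha,\phi):=\int_0^{\phi}\frac{dx}{\sqrt{\cos 2x-\cos 2\alpha}}$ (these are convergent, possibly improper, integrals; $T_1(\alpha,\alpha)=T(\alpha)$). *)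

(* Defs.v *)
From Stdlib Require Import Reals.
From Coquelicot Require Import Coquelicot.
Open Scope R_scope.

Definition integrand (alpha x : R) : R :=
  / sqrt (cos (2 * x) - cos (2 * alpha)).

(* Improper Riemann integral over (0, alpha): the integrand is unbounded at
   the right endpoint, so the integral is the limit of the proper integrals
   over [0, y] as y increases to alpha. *)
Definition T (alpha : R) : R :=
  RInt_gen (integrand alpha) (at_point 0) (at_left alpha).

(* Meant for 0 < phi <= alpha.  For phi < alpha the integrand is continuous on
   [0, phi] and this is the ordinary Riemann integral; for phi = alpha it is
   improper and equals T alpha. *)
Definition T1 (alpha phi : R) : R :=
  RInt_gen (integrand alpha) (at_point 0) (at_left phi).

Definition T_Cr (phi0 phi1 alpha : R) : R :=
  2 * T alpha + T1 alpha phi0 - T1 alpha phi1.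

Definition T_star (phi0 phi1 : R) : R :=
  T phi1 + T1 phi1 phi0.

(* Main.v *)
Require Import Defs.
From Stdlib Require Import Reals Lra.
From Coquelicot Require Import Coquelicot.
Open Scope R_scope.

(** Write [T_Cr] as [2 T - (T1 phi1 - T1 phi0)].

    Monotonicity needs no derivative in [alpha].  The difference
    [T1 alpha phi1 - T1 alpha phi0] is the proper integral of [integrand alpha]
    over the interval from [phi0] to [phi1], on which the integrand strictly
    decreases as [alpha] grows ([T1_increment_decreasing]); so it suffices that
    [T] is nondecreasing.  This is not visible on the original integral, whose
    integrand decreases while its domain grows, but it becomes visible after the
    classical substitution [sin x = sin alpha * sin theta].  That substitution
    turns [T1 alpha phi] into an incomplete elliptic integral of the first kind
    of modulus [sin alpha] and amplitude [asin (sin phi / sin alpha)]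
    ([T1_eq_ellF]).  For [T] the amplitude is the constant [PI / 2], and the new
    integrand increases with the modulus.

    The limit comes from the same formula.  Changing the modulus from [s] to
    [t >= s] multiplies the elliptic integral by a factor between [1] and
    [sqrt ((1 - s^2) / (1 - t^2))] ([ellF_modulus_bounds]), and this factor tends
    to [1].  A squeeze gives right continuity of [T] and of each [T1 _ phi], also
    at the singular value [alpha = phi], where only continuity of [asin] at [1]
    is at stake.  Since [T1 phi1 phi1 = T phi1], the limit of [T_Cr] at [phi1] is
    [T_star].  The strict lower bound follows: below any [alpha] there is a
    further [gamma] with [T_star <= T_Cr gamma < T_Cr alpha]. *)

(** * Elliptic integrals of the first kind *)

(** The factor [2], absent from the Legendre normal form, makes the
    substituted integrals equal to [T] and [T1] without a constant
    [/ sqrt 2]. *)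
Definition ell (s theta : R) : R := / sqrt (2 * (1 - (s * sin theta)²)).

Definition ellF (s u : R) : R := RInt (ell s) 0 u.

(** The value of [theta] that corresponds to [x] under
    [sin x = sin alpha * sin theta]. *)
Definition amplitude (alpha x : R) : R := asin (sin x / sin alpha).

Lemma asin_increasing_le (x y : R) :
  -1 <= x -> x <= y -> y <= 1 -> asin x <= asin y.
Proof.
  intros Hx Hxy Hy.
  destruct (asin_bound x), (asin_bound y).
  apply sin_incr_0; try lra.
  rewrite !sin_asin; lra.
Qed.

(** At [1] the derivative of [asin] is infinite; continuity there comes from
    monotonicity and [asin (cos e) = PI / 2 - e], together with the convention
    that [asin] is constantly [PI / 2] to the right of [1]. *)
Lemma continuous_asin (y : R) : 0 <= y <= 1 -> continuous asin y.
Proof.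
  intros [Hy0 [Hy1 | ->]].
  - apply continuity_pt_filterlim.
    apply derivable_continuous_pt, derivable_pt_asin; lra.
  - apply (proj2 (filterlim_locally _ _)); intros eps.
    rewrite asin_1.
    pose proof PI_RGT_0 as Hpi.
    set (e := Rmin (eps / 2) (PI / 2)).
    assert (He : 0 < e).
    { apply Rmin_glb_lt; [destruct eps; simpl; lra | lra]. }
    assert (He1 : e <= eps / 2) by apply Rmin_l.
    assert (He2 : e <= PI / 2) by apply Rmin_r.
    assert (Hc0 : 0 <= cos e) by (apply cos_ge_0; lra).
    assert (Hc : cos e < 1).
    { rewrite <- cos_0. apply cos_decreasing_1; lra. }
    assert (Hd : 0 < 1 - cos e) by lra.
    exists (mkposreal _ Hd); intros z Hz.
    assert (Hz' : Rabs (z - 1) < 1 - cos e) by exact Hz.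
    apply Rabs_lt_between in Hz'.
    destruct (asin_bound z) as [_ Hup].
    assert (Hlow : PI / 2 - e <= asin z).
    { destruct (Rle_lt_dec z 1) as [Hz1 | Hz1].
      - rewrite <- (asin_sin (PI / 2 - e)) by lra.
        rewrite sin_shift. apply asin_increasing_le; lra.
      - unfold asin. destruct (Rle_dec z (-1)); [lra |].
        destruct (Rle_dec 1 z); lra. }
    change (Rabs (asin z - PI / 2) < eps).
    destruct eps as [eps Heps]; simpl in *.
    apply Rabs_lt_between; lra.
Qed.

Lemma ell_radicand_pos (s theta : R) :
  0 <= s < 1 -> 1 - s² <= 1 - (s * sin theta)² /\ 0 < 1 - s².
Proof.
  intros Hs.
  pose proof (sin2_cos2 theta) as H.
  rewrite Rsqr_mult.
  pose proof (Rle_0_sqr (cos theta)). pose proof (Rle_0_sqr s).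
  split; [nra | unfold Rsqr; nra].
Qed.

Lemma continuous_ell (s theta : R) : 0 <= s < 1 -> continuous (ell s) theta.
Proof.
  intros Hs.
  destruct (ell_radicand_pos s theta Hs).
  apply (ex_derive_continuous (ell s)). unfold ell, Rsqr in *.
  auto_derive; repeat split; try lra.
  apply Rgt_not_eq, sqrt_lt_R0; lra.
Qed.

Lemma ex_RInt_ell (s a b : R) : 0 <= s < 1 -> ex_RInt (ell s) a b.
Proof.
  intros Hs. apply (ex_RInt_continuous (V := R_CompleteNormedModule)).
  intros; now apply continuous_ell.
Qed.

Lemma is_derive_ellF (s u : R) : 0 <= s < 1 -> is_derive (ellF s) u (ell s u).
Proof.
  intros Hs.
  apply (is_derive_RInt (ell s) (ellF s) 0).
  - apply filter_forall; intros v.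
    apply (RInt_correct (V := R_CompleteNormedModule)), ex_RInt_ell, Hs.
  - now apply continuous_ell.
Qed.

(** Both bounds hold pointwise for the integrands.  With [r = (sin x)^2] in the
    unit interval, [(1 - s^2 r) / (1 - t^2 r)] lies between its values at [r = 0]
    and [r = 1], namely [1] and [(1 - s^2) / (1 - t^2)]. *)
Lemma ellF_modulus_bounds (s t u : R) :
  0 <= s <= t -> t < 1 -> 0 <= u ->
  ellF s u <= ellF t u <= sqrt ((1 - s²) / (1 - t²)) * ellF s u.
Proof.
  intros Hst Ht Hu.
  assert (Hs1 : 0 <= s < 1) by lra. assert (Ht1 : 0 <= t < 1) by lra.
  assert (Hsq : s² <= t²) by (unfold Rsqr; nra).
  split.
  - apply RInt_le; try (now apply ex_RInt_ell); [lra |].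
    intros x _. unfold ell.
    destruct (ell_radicand_pos s x Hs1), (ell_radicand_pos t x Ht1).
    apply Rinv_le_contravar; [apply sqrt_lt_R0; lra |].
    apply sqrt_le_1_alt.
    rewrite !Rsqr_mult. pose proof (Rle_0_sqr (sin x)). nra.
  - unfold ellF.
    rewrite <- (RInt_scal (V := R_CompleteNormedModule)) by now apply ex_RInt_ell.
    apply RInt_le; [lra | now apply ex_RInt_ell | |].
    + apply (ex_RInt_scal (V := R_NormedModule)); now apply ex_RInt_ell.
    + intros x _. change scal with Rmult. unfold ell.
      destruct (ell_radicand_pos s x Hs1), (ell_radicand_pos t x Ht1).
      rewrite <- !sqrt_inv, <- sqrt_mult_alt
        by (apply Rlt_le, Rdiv_lt_0_compat; lra).
      apply sqrt_le_1_alt.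
      (* Clear all denominators at once; what remains is
         (t^2 - s^2) * (1 - (sin x)^2) >= 0. *)
      apply Rmult_le_reg_r with
        (2 * (1 - (t * sin x)²) * (1 - (s * sin x)²) * (1 - t²));
        [apply Rmult_lt_0_compat; nra |].
      field_simplify; try lra.
      assert (Hx : (sin x)² <= 1).
      { pose proof (sin2_cos2 x). pose proof (Rle_0_sqr (cos x)). lra. }
      rewrite !Rsqr_mult.
      pose proof (Rmult_le_pos (t² - s²) (1 - (sin x)²)). nra.
Qed.

(** * The substitution sin x = sin alpha * sin theta *)

Lemma sin_range (alpha : R) : 0 < alpha < PI / 2 -> 0 < sin alpha < 1.
Proof.
  intros H. split.
  - apply sin_gt_0; lra.
  - rewrite <- sin_PI2. apply sin_increasing_1; lra.
Qed.

Lemma sin_ratio_range (alpha x : R) :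
  0 <= x <= alpha -> 0 < alpha < PI / 2 -> 0 <= sin x / sin alpha <= 1.
Proof.
  intros Hx Ha. destruct (sin_range alpha Ha) as [Hs _].
  assert (0 <= sin x) by (apply sin_ge_0; lra).
  assert (sin x <= sin alpha) by (apply sin_incr_1; lra).
  split.
  - apply Rdiv_le_0_compat; lra.
  - apply Rmult_le_reg_r with (sin alpha); [lra |].
    unfold Rdiv. rewrite Rmult_assoc, Rinv_l; lra.
Qed.

Lemma amplitude_ge_0 (alpha x : R) :
  0 <= x <= alpha -> 0 < alpha < PI / 2 -> 0 <= amplitude alpha x.
Proof.
  intros Hx Ha. pose proof (sin_ratio_range alpha x Hx Ha).
  rewrite <- asin_0. apply asin_increasing_le; lra.
Qed.

Lemma amplitude_0 (alpha : R) : amplitude alpha 0 = 0.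
Proof. unfold amplitude, Rdiv. now rewrite sin_0, Rmult_0_l, asin_0. Qed.

Lemma amplitude_diag (alpha : R) :
  0 < alpha < PI / 2 -> amplitude alpha alpha = PI / 2.
Proof.
  intros Ha. destruct (sin_range alpha Ha).
  unfold amplitude, Rdiv. rewrite Rinv_r by lra. apply asin_1.
Qed.

Lemma radicand_pos (alpha x : R) :
  0 <= x < alpha -> alpha < PI / 2 -> 0 < cos (2 * x) - cos (2 * alpha).
Proof.
  intros Hx Ha.
  assert (cos (2 * alpha) < cos (2 * x)) by (apply cos_decreasing_1; lra).
  lra.
Qed.

Lemma continuous_integrand (alpha x : R) :
  0 <= x < alpha -> alpha < PI / 2 -> continuous (integrand alpha) x.
Proof.
  intros Hx Ha. pose proof (radicand_pos alpha x Hx Ha).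
  apply (ex_derive_continuous (integrand alpha)). unfold integrand.
  auto_derive; repeat split; try lra.
  apply Rgt_not_eq, sqrt_lt_R0; lra.
Qed.

(** The change of variables in infinitesimal form.  Because
    [sin alpha * sin theta = sin x], the elliptic integrand at the amplitude is
    [/ (sqrt 2 * cos x)], and this [cos x] cancels the one produced by
    differentiating the amplitude. *)
Lemma is_derive_ellF_amplitude (alpha x : R) :
  0 <= x < alpha -> alpha < PI / 2 ->
  is_derive (fun y => ellF (sin alpha) (amplitude alpha y)) x (integrand alpha x).
Proof.
  intros Hx Ha.
  destruct (sin_range alpha) as [Hs0 Hs1]; [lra |].
  assert (Hr : -1 < sin x / sin alpha < 1).
  { destruct (sin_ratio_range alpha x) as [Hr _]; [lra | lra |].
    split; [lra |].
    apply Rmult_lt_reg_r with (sin alpha); [lra |].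
    unfold Rdiv. rewrite Rmult_assoc, Rinv_l, Rmult_1_r, Rmult_1_l by lra.
    apply sin_increasing_1; lra. }
  assert (Hc : 0 < cos x) by (apply cos_gt_0; lra).
  set (w := 1 - (sin x / sin alpha)²).
  assert (Hw : 0 < w) by (unfold w, Rsqr; nra).
  assert (Hval : integrand alpha x
    = (/ sqrt w * (cos x / sin alpha)) * ell (sin alpha) (amplitude alpha x)).
  { unfold ell, amplitude. rewrite sin_asin by lra.
    replace (sin alpha * (sin x / sin alpha)) with (sin x) by (field; lra).
    replace (1 - (sin x)²) with ((cos x)²) by (rewrite cos2; ring).
    rewrite sqrt_mult, sqrt_Rsqr by (try apply Rle_0_sqr; lra).
    unfold integrand.
    (* cos 2x - cos 2 alpha = 2 (sin^2 alpha - sin^2 x) *)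
    replace (cos (2 * x) - cos (2 * alpha)) with (2 * ((sin alpha)² * w)).
    - rewrite sqrt_mult, sqrt_mult, sqrt_Rsqr
        by (try apply Rmult_le_pos; try apply Rle_0_sqr; lra).
      assert (0 < sqrt w) by (apply sqrt_lt_R0; lra).
      assert (0 < sqrt 2) by (apply sqrt_lt_R0; lra).
      field. repeat split; lra.
    - unfold w, Rsqr. rewrite !cos_2a_sin. field. lra. }
  rewrite Hval.
  apply (is_derive_comp (ellF (sin alpha)) (amplitude alpha)).
  - apply is_derive_ellF; lra.
  - unfold amplitude.
    replace (/ sqrt w * (cos x / sin alpha))
      with (scal (cos x / sin alpha) (/ sqrt w))
      by (apply Rmult_comm).
    apply (is_derive_comp asin (fun y => sin y / sin alpha)).
    + apply is_derive_Reals.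
      replace (/ sqrt w) with (derive_pt asin _ (derivable_pt_asin _ Hr)).
      * apply (derive_pt_eq_1 asin _ _ (derivable_pt_asin _ Hr)). reflexivity.
      * rewrite derive_pt_asin. fold w. unfold Rdiv. apply Rmult_1_l.
    + auto_derive; [easy | field; lra].
Qed.

Lemma is_RInt_integrand (alpha a b : R) :
  0 <= a -> a <= b -> b < alpha -> alpha < PI / 2 ->
  is_RInt (integrand alpha) a b
    (ellF (sin alpha) (amplitude alpha b) - ellF (sin alpha) (amplitude alpha a)).
Proof.
  intros Ha Hab Hb Hal.
  apply (is_RInt_derive (V := R_CompleteNormedModule)
    (fun y => ellF (sin alpha) (amplitude alpha y)));
    rewrite Rmin_left, Rmax_right by lra; intros x Hx.
  - apply is_derive_ellF_amplitude; lra.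
  - apply continuous_integrand; lra.
Qed.

(** The proper case [phi < alpha] and the improper case [phi = alpha] are handled
    together: the primitive [ellF (sin alpha) (amplitude alpha y)] remains
    continuous at [y = alpha], although it is not differentiable there.  That
    continuity also proves that the improper integral converges. *)
Lemma T1_eq_ellF (alpha phi : R) :
  0 < phi <= alpha -> alpha < PI / 2 ->
  T1 alpha phi = ellF (sin alpha) (amplitude alpha phi).
Proof.
  intros Hphi Ha. destruct (sin_range alpha) as [Hs0 Hs1]; [lra |].
  unfold T1.
  apply (is_RInt_gen_unique (V := R_CompleteNormedModule)).
  assert (Hlim : filterlim (fun y => ellF (sin alpha) (amplitude alpha y))
      (at_left phi) (locally (ellF (sin alpha) (amplitude alpha phi)))).
  { apply (filterlim_filter_le_1 (G := at_left phi) (F := locally phi)).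
    { apply filter_le_within. }
    apply (continuous_comp (amplitude alpha) (ellF (sin alpha)) phi).
    - apply (continuous_comp (fun y => sin y / sin alpha) asin phi).
      + apply (ex_derive_continuous (fun y => sin y / sin alpha)).
        auto_derive; easy.
      + apply continuous_asin, sin_ratio_range; lra.
    - apply (ex_derive_continuous (ellF (sin alpha))).
      eexists. apply is_derive_ellF; lra. }
  intros P HP.
  apply (Filter_prod _ _ _ (fun x => x = 0)
    (fun y => (0 < y /\ y < phi)
              /\ P (ellF (sin alpha) (amplitude alpha y)))).
  - reflexivity.
  - apply filter_and; [apply filter_and | now apply Hlim].
    + apply filter_le_within. now apply (open_gt 0).
    + now apply (filter_forall (F := locally phi)).
  - intros x y -> [Hy HPy].
    exists (ellF (sin alpha) (amplitude alpha y)). split; [| exact HPy].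
    pose proof (is_RInt_integrand alpha 0 y) as H.
    rewrite amplitude_0 in H. unfold ellF at 2 in H.
    rewrite RInt_point in H. change zero with 0 in H.
    rewrite Rminus_0_r in H. apply H; lra.
Qed.

Lemma T_eq_ellF (alpha : R) :
  0 < alpha < PI / 2 -> T alpha = ellF (sin alpha) (PI / 2).
Proof.
  intros Ha. rewrite <- (amplitude_diag alpha Ha).
  apply (T1_eq_ellF alpha alpha); lra.
Qed.

(** * Monotonicity in alpha *)

Lemma T_increasing (alpha beta : R) :
  0 < alpha <= beta -> beta < PI / 2 -> T alpha <= T beta.
Proof.
  intros Hab Hb. rewrite !T_eq_ellF by lra.
  destruct (sin_range alpha), (sin_range beta); try lra.
  apply ellF_modulus_bounds; try lra.
  split; [lra |]. apply sin_incr_1; lra.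
Qed.

Lemma T1_increment_decreasing (phi0 phi1 alpha beta : R) :
  0 < phi0 < phi1 -> phi1 < alpha < beta -> beta < PI / 2 ->
  T1 beta phi1 - T1 beta phi0 < T1 alpha phi1 - T1 alpha phi0.
Proof.
  intros Hphi Hab Hb. rewrite !T1_eq_ellF by lra.
  rewrite <- (is_RInt_unique _ _ _ _ (is_RInt_integrand alpha phi0 phi1
    ltac:(lra) ltac:(lra) ltac:(lra) ltac:(lra))).
  rewrite <- (is_RInt_unique _ _ _ _ (is_RInt_integrand beta phi0 phi1
    ltac:(lra) ltac:(lra) ltac:(lra) ltac:(lra))).
  apply RInt_lt; try lra.
  - intros; apply continuous_integrand; lra.
  - intros; apply continuous_integrand; lra.
  - intros x Hx. unfold integrand.
    pose proof (radicand_pos alpha x).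
    assert (cos (2 * beta) < cos (2 * alpha))
      by (apply cos_decreasing_1; lra).
    apply Rinv_lt_contravar.
    + apply Rmult_lt_0_compat; apply sqrt_lt_R0; lra.
    + apply sqrt_lt_1_alt; lra.
Qed.

(** * Right continuity in alpha *)

(** The modulus is first frozen at [sin alpha], where continuity in the amplitude
    suffices; the error made by freezing it is controlled by the squeeze of
    [ellF_modulus_bounds]. *)
Lemma ellF_right_limit (alpha : R) (u : R -> R) :
  0 < alpha < PI / 2 -> continuous u alpha ->
  (forall x, alpha < x < PI / 2 -> 0 <= u x) ->
  filterlim (fun x => ellF (sin x) (u x)) (at_right alpha)
    (locally (ellF (sin alpha) (u alpha))).
Proof.
  intros Ha Hu Hpos. destruct (sin_range alpha Ha) as [Hs0 Hs1].
  assert (HF : continuous (fun x => ellF (sin alpha) (u x)) alpha).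
  { apply (continuous_comp u (ellF (sin alpha))); [exact Hu |].
    apply (ex_derive_continuous (ellF (sin alpha))).
    eexists. apply is_derive_ellF; lra. }
  assert (Hratio : continuous
    (fun x => sqrt ((1 - (sin alpha)²) / (1 - (sin x)²))) alpha).
  { apply continuous_sqrt_comp.
    apply (ex_derive_continuous
      (fun x => (1 - (sin alpha)²) / (1 - (sin x)²))).
    unfold Rsqr. auto_derive. nra. }
  apply (filterlim_le_le (fun x => ellF (sin alpha) (u x)) _
    (fun x => sqrt ((1 - (sin alpha)²) / (1 - (sin x)²))
              * ellF (sin alpha) (u x)) (Finite _)).
  - apply (filter_imp (fun x => alpha < x /\ x < PI / 2)).
    + intros x Hx. destruct (sin_range x); [lra |].
      apply ellF_modulus_bounds; try lra.
      * split; [lra |]. apply sin_incr_1; lra.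
      * apply Hpos, Hx.
    + apply filter_and.
      * now apply (filter_forall (F := locally alpha)).
      * apply filter_le_within. apply (open_lt (PI / 2)); lra.
  - eapply filterlim_filter_le_1; [apply filter_le_within | exact HF].
  - eapply filterlim_filter_le_1; [apply filter_le_within |].
    pose proof (continuous_mult _ _ _ Hratio HF) as H.
    unfold continuous in H. change mult with Rmult in H. cbv beta in H.
    replace (Rbar_locally (ellF (sin alpha) (u alpha)))
      with (locally (sqrt ((1 - (sin alpha)²) / (1 - (sin alpha)²))
                     * ellF (sin alpha) (u alpha))); [exact H |].
    simpl. f_equal.
    unfold Rdiv. rewrite Rinv_r, sqrt_1, Rmult_1_l; [easy |].
    unfold Rsqr; nra.
Qed.

Lemma filterlim_at_right_ext (a b l : R) (f g : R -> R) :
  a < b -> (forall x, a < x < b -> f x = g x) ->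
  filterlim g (at_right a) (locally l) -> filterlim f (at_right a) (locally l).
Proof.
  intros Hab Heq. apply filterlim_ext_loc.
  apply (filter_imp (fun x => a < x /\ x < b)).
  - intros x Hx. symmetry. apply Heq, Hx.
  - apply filter_and.
    + now apply (filter_forall (F := locally a)).
    + apply filter_le_within. now apply (open_lt b).
Qed.

Lemma T_right_continuous (alpha : R) :
  0 < alpha < PI / 2 -> filterlim T (at_right alpha) (locally (T alpha)).
Proof.
  intros Ha. rewrite T_eq_ellF by lra.
  apply (filterlim_at_right_ext _ (PI / 2) _ _
    (fun x => ellF (sin x) (PI / 2))); [lra | |].
  - intros; apply T_eq_ellF; lra.
  - apply (ellF_right_limit alpha (fun _ => PI / 2) Ha).
    + apply continuous_const.
    + intros; lra.
Qed.

Lemma T1_right_continuous (alpha phi : R) :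
  0 < phi <= alpha -> alpha < PI / 2 ->
  filterlim (fun x => T1 x phi) (at_right alpha) (locally (T1 alpha phi)).
Proof.
  intros Hphi Ha. rewrite T1_eq_ellF by lra.
  destruct (sin_range alpha) as [Hs0 Hs1]; [lra |].
  apply (filterlim_at_right_ext _ (PI / 2) _ _
    (fun x => ellF (sin x) (amplitude x phi))); [lra | |].
  - intros; apply T1_eq_ellF; lra.
  - apply (ellF_right_limit alpha (fun x => amplitude x phi)); [lra | |].
    + apply (continuous_comp (fun x => sin phi / sin x) asin alpha).
      * apply (ex_derive_continuous (fun x => sin phi / sin x)).
        auto_derive; lra.
      * apply continuous_asin, sin_ratio_range; lra.
    + intros; apply amplitude_ge_0; lra.
Qed.

(** * The combined function *)

Theorem mainTheorem2 (phi0 phi1 : R)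
  (Hphi0 : 0 < phi0) (Hphi01 : phi0 < phi1) (Hphi1 : phi1 < PI / 2) :
  (forall alpha beta : R,
      phi1 < alpha -> alpha < beta -> beta < PI / 2 ->
      T_Cr phi0 phi1 alpha < T_Cr phi0 phi1 beta) /\
  filterlim (T_Cr phi0 phi1) (at_right phi1) (locally (T_star phi0 phi1)) /\
  (forall alpha : R,
      phi1 < alpha < PI / 2 -> T_star phi0 phi1 < T_Cr phi0 phi1 alpha).
Proof.
  assert (Hincr : forall alpha beta : R,
      phi1 < alpha -> alpha < beta -> beta < PI / 2 ->
      T_Cr phi0 phi1 alpha < T_Cr phi0 phi1 beta).
  { intros alpha beta Ha Hab Hb. unfold T_Cr.
    pose proof (T_increasing alpha beta).
    pose proof (T1_increment_decreasing phi0 phi1 alpha beta). lra. }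
  assert (Hlim : filterlim (T_Cr phi0 phi1) (at_right phi1)
                   (locally (T_star phi0 phi1))).
  { unfold T_star, T_Cr.
    (* T and T1 on the diagonal are the same term, so one of the two copies of
       T phi1 cancels. *)
    replace (T phi1 + T1 phi1 phi0)
      with (2 * T phi1 + T1 phi1 phi0 - T1 phi1 phi1)
      by (change (T1 phi1 phi1) with (T phi1); ring).
    apply (filterlim_comp_2 (G := locally (2 * T phi1 + T1 phi1 phi0))
      (H := locally (- T1 phi1 phi1))
      (fun x => 2 * T x + T1 x phi0) (fun x => - T1 x phi1) Rplus).
    - apply (filterlim_comp_2 (G := locally (2 * T phi1))
        (H := locally (T1 phi1 phi0))
        (fun x => 2 * T x) (fun x => T1 x phi0) Rplus).
      + eapply filterlim_comp; [apply T_right_continuous; lra |].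
        apply (filterlim_scal_r (V := R_NormedModule) 2).
      + apply T1_right_continuous; lra.
      + apply (filterlim_plus (V := R_NormedModule)).
    - eapply filterlim_comp; [apply T1_right_continuous; lra |].
      apply (filterlim_opp (V := R_NormedModule)).
    - apply (filterlim_plus (V := R_NormedModule)). }
  split; [exact Hincr | split; [exact Hlim |]].
  (* Compare the limit with an intermediate value, because passing to the limit
     only preserves weak inequalities. *)
  intros alpha Ha.
  set (gamma := (phi1 + alpha) / 2).
  apply Rle_lt_trans with (T_Cr phi0 phi1 gamma);
    [| apply Hincr; unfold gamma; lra].
  apply (filterlim_le (F := at_right phi1) (T_Cr phi0 phi1)
    (fun _ => T_Cr phi0 phi1 gamma) (Finite _) (Finite _)).
  - apply (filter_imp (fun x => phi1 < x /\ x < gamma)).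
    + intros x Hx. apply Rlt_le, Hincr; unfold gamma in *; lra.
    + apply filter_and.
      * now apply (filter_forall (F := locally phi1)).
      * apply filter_le_within. apply (open_lt gamma). unfold gamma; lra.
  - exact Hlim.
  - apply filterlim_const.
Qed.
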